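(* Orient the reverse adjacent transfers on staircase codes of length $N$ by $$R_i(c)=c+\mathbf e_i-\mathbf e_{i+1}\quad\text{if}\quad c_{i+1}>0\ \text{ and }\ c_i\le C_i-2\qquad(1\le i<N).$$ This rewriting system is terminating and confluent. Its irreducible codes are characterized by the condition that, for all $1\le i<N$, $$c_{i+1}>0\quad\Longrightarrow\quad c_i\in\{C_i-1,C_i\},$$ and their number is $2^N-N$.
   Context: A staircase code is an integer vector $c=(c_1,\dots,c_N)$ with $0\le c_i\le C_i:=N-i$; $\mathbf e_i$ is the $i$th standard basis vector of $\mathbb Z^N$. A rewriting step replaces $c$ by $R_i(c)$ for some $i$ for which $R_i$ is defined at $c$; a code is irreducible if no $R_i$ is defined at it. *)

(* Defs.v *)
From HB Require Import structures.
From Stdlib Require Export Relations.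
From mathcomp Require Export all_boot all_order all_algebra.
From mathcomp Require Import zify.

Set Implicit Arguments.
Unset Strict Implicit.
Unset Printing Implicit Defensive.

Import Order.TTheory GRing.Theory Num.Theory.
Local Open Scope ring_scope.

Definition terminating (T : Type) (step : T -> T -> Prop) : Prop :=
  ~ exists f : nat -> T, forall n, step (f n) (f n.+1).

Definition confluent (T : Type) (step : T -> T -> Prop) : Prop :=
  forall x y z : T,
    clos_refl_trans T step x y -> clos_refl_trans T step x z ->
    exists w : T, clos_refl_trans T step y w /\ clos_refl_trans T step z w.

(** Coordinates are 0-based: the mathematical index [k = 1, ..., N] is the ordinal [i : 'I_N] with value [k - 1], so that
    [C_k = N - k] reads [N - (i + 1)]. *)

Definition cap (N : nat) (i : 'I_N) : int := N%:Z - i.+1%:Z.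

Definition staircase (N : nat) (c : 'rV[int]_N) : bool :=
  [forall i, 0 <= c 0 i <= cap i].

Record code (N : nat) : Type :=
  Code { code_val :> 'rV[int]_N; _ : staircase code_val }.

Arguments Code {N} code_val _.

HB.instance Definition _ N := [isSub for @code_val N].
HB.instance Definition _ N := [Countable of code N by <:].

Lemma code_bound (N : nat) (c : code N) (i : 'I_N) : 0 <= c 0 i <= cap i.
Proof. by case: c => c /= /forallP. Qed.

Lemma code_lt (N : nat) (c : code N) (i : 'I_N) : (`|c 0%R i| < N)%N.
Proof. by have := code_bound c i; have := ltn_ord i; rewrite /cap; lia. Qed.

Definition code_ffun (N : nat) (c : code N) : {ffun 'I_N -> 'I_N} :=
  [ffun i => Ordinal (code_lt c i)].

Lemma code_ffun_inj (N : nat) : injective (@code_ffun N).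
Proof.
move=> c d /ffunP eq_cd; apply/val_inj/rowP => i /=.
have := code_bound c i; have := code_bound d i.
by have := eq_cd i; rewrite !ffunE => -[]; lia.
Qed.

Definition ffun_code (N : nat) (f : {ffun 'I_N -> 'I_N}) : option (code N) :=
  insub (\row_i (f i)%:Z).

Lemma code_ffunK (N : nat) : pcancel (@code_ffun N) (@ffun_code N).
Proof.
move=> c; rewrite /ffun_code; set r := \row_i _.
have -> : r = val c; last by rewrite valK.
by apply/rowP => i; rewrite !mxE ffunE /=; have := code_bound c i; lia.
Qed.

HB.instance Definition _ N := isFinite.Build (code N) (pcan_enumP (@code_ffunK N)).

(** The mathematical index [1 <= k < N] is the
    ordinal [i : 'I_N.-1] with value [k - 1]; [cur i] and [nxt i] are the
    coordinates [k] and [k + 1]. *)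

Definition cur (N : nat) (i : 'I_N.-1) : 'I_N := widen_ord (leq_pred N) i.

Lemma nxt_subproof (N : nat) (i : 'I_N.-1) : (i.+1 < N)%N.
Proof. by rewrite -ltn_predRL. Qed.

Definition nxt (N : nat) (i : 'I_N.-1) : 'I_N := Ordinal (nxt_subproof i).

Definition basis_vec (N : nat) (i : 'I_N) : 'rV[int]_N := delta_mx 0 i.

Definition transfer_defined (N : nat) (i : 'I_N.-1) (c : code N) : bool :=
  (0 < c 0 (nxt i)) && (c 0 (cur i) <= cap (cur i) - 2).

Definition transfer_vec (N : nat) (i : 'I_N.-1) (c : 'rV[int]_N) : 'rV[int]_N :=
  c + basis_vec (cur i) - basis_vec (nxt i).

Lemma transfer_staircase (N : nat) (i : 'I_N.-1) (c : code N) :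
  transfer_defined i c -> staircase (transfer_vec i c).
Proof.
case/andP=> c_gt0 c_le; apply/forallP => j; rewrite !mxE /=.
have := code_bound c j.
have [eq_p|_] := eqVneq j (cur i); have [eq_n|_] := eqVneq j (nxt i);
  rewrite /= ?mulr1n ?mulr0n; try by subst; lia.
Qed.

Definition transfer (N : nat) (i : 'I_N.-1) (c : code N)
    (def_ic : transfer_defined i c) : code N :=
  Code (transfer_vec i c) (transfer_staircase def_ic).

Definition transfer_step (N : nat) (c d : code N) : Prop :=
  exists (i : 'I_N.-1) (def_ic : transfer_defined i c), d = transfer def_ic.

Definition irreducible (N : nat) (c : code N) : bool :=
  [forall i : 'I_N.-1, ~~ transfer_defined i c].

(* Main.v *)
Require Import Defs.
From mathcomp Require Import zify ring.

(** Why the theorem holds.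

    Termination: the moment [\sum_k k * c_k] is nonnegative on codes, and moving
    one unit from coordinate [i + 1] to coordinate [i] lowers it by exactly one.

    Confluence: two distinct transfers available at the same code never disable
    each other.  Only adjacent indices [i] and [i + 1] interact, through the
    coordinate [c_(i+1)]: [R_i] lowers it, which respects the upper bound that
    [R_(i+1)] requires, and [R_(i+1)] raises it, which respects the positivity
    that [R_i] requires.  Transfers being translations, they commute, so the
    system has the diamond property, which gives confluence without Newman's
    lemma.

    Counting: in an irreducible code a zero coordinate is followed by zeros only.
    Hence a code of length [N + 1] with first coordinate [a] and tail [c] is
    irreducible exactly when [c] is, and either [c] is zero or [a] is one of the
    two largest values [N - 1], [N].  The number [I_N] of irreducible codes
    satisfies [I_(N+1) = (N + 1) + 2 * (I_N - 1)], whose solution is [2^N - N]. *)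

Set Implicit Arguments.
Unset Strict Implicit.
Unset Printing Implicit Defensive.

Import Order.TTheory GRing.Theory Num.Theory.
Local Open Scope ring_scope.

(** * Termination *)

(** The moment of a vector, the weights being the 0-based positions. *)
Definition moment (N : nat) (c : 'rV[int]_N) : int := \sum_(i < N) i%:Z * c 0 i.

Lemma moment_ge0 (N : nat) (c : code N) : 0 <= moment c.
Proof.
by apply: sumr_ge0 => i _; case/andP: (code_bound c i) => c_ge0 _; rewrite mulr_ge0.
Qed.

Lemma momentD (N : nat) (c d : 'rV[int]_N) : moment (c + d) = moment c + moment d.
Proof.
by rewrite /moment -big_split; apply: eq_bigr => i _; rewrite mxE mulrDr.
Qed.

Lemma momentN (N : nat) (c : 'rV[int]_N) : moment (- c) = - moment c.
Proof. by rewrite /moment -sumrN; apply: eq_bigr => i _; rewrite mxE mulrN. Qed.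

Lemma moment_basis (N : nat) (k : 'I_N) : moment (basis_vec k) = k%:Z.
Proof.
rewrite /moment (bigD1 k) //= big1 => [|i ne_ik].
  by rewrite mxE !eqxx mulr1 addr0.
by rewrite mxE (negPf ne_ik) andbF mulr0.
Qed.

Lemma moment_step (N : nat) (c d : code N) :
  transfer_step c d -> moment d = moment c - 1.
Proof.
case=> i [def_ic ->]; rewrite /= /transfer_vec !momentD momentN !moment_basis /=.
lia.
Qed.

Lemma terminating_transfer (N : nat) : terminating (@transfer_step N).
Proof.
case=> f step_f.
have moment_f n : moment (f n) = moment (f 0%N) - n%:Z.
  by elim: n => [|n IHn]; [lia | rewrite (moment_step (step_f n)) IHn; lia].
have := moment_f (`|moment (f 0%N)|.+1)%N.
have := moment_ge0 (f `|moment (f 0%N)|.+1%N); have := moment_ge0 (f 0%N).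
lia.
Qed.

(** * Confluence *)

Lemma transferE (N : nat) (i : 'I_N.-1) (c : code N) (def_ic : transfer_defined i c)
    (k : 'I_N) :
  transfer def_ic 0 k = c 0 k + (k == cur i)%:R - (k == nxt i)%:R.
Proof. by rewrite !mxE eqxx. Qed.

(** Distinct available transfers do not disable each other. *)
Lemma transfer_defined_transfer (N : nat) (i j : 'I_N.-1) (c : code N)
    (def_ic : transfer_defined i c) :
  i != j -> transfer_defined j c -> transfer_defined j (transfer def_ic).
Proof.
rewrite -val_eqE /= => ne_ij /andP[cj_gt0 cj_le]; case/andP: (def_ic) => ci_gt0 ci_le.
by apply/andP; rewrite !transferE -!val_eqE /=; split; lia.
Qed.

Lemma transfer_vecC (N : nat) (i j : 'I_N.-1) (c : 'rV[int]_N) :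
  transfer_vec i (transfer_vec j c) = transfer_vec j (transfer_vec i c).
Proof. by apply/rowP => k; rewrite !mxE; ring. Qed.

(** The diamond property, allowing the two one-step reducts to coincide. *)
Definition diamond (T : Type) (step : T -> T -> Prop) : Prop :=
  forall x y z, step x y -> step x z ->
  y = z \/ exists w, step y w /\ step z w.

(** One step against many: the many-step side needs at most one step to close. *)
Lemma diamond_strip (T : Type) (step : T -> T -> Prop) (x y z : T) :
  diamond step -> step x y -> clos_refl_trans_1n T step x z ->
  exists2 w, clos_refl_trans_1n T step y w & z = w \/ step z w.
Proof.
move=> dia xy xz; elim: xz y xy => {x z} [x | x u z xu uz IHz] y xy.
  by exists y; [constructor | right].
case: (dia _ _ _ xy xu) => [-> | [v [yv uv]]]; first by exists z => //; left.
by case: (IHz v uv) => w vw zw; exists w => //; apply: Relation_Operators.rt1n_trans vw.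
Qed.

Lemma diamond_confluent (T : Type) (step : T -> T -> Prop) :
  diamond step -> confluent step.
Proof.
move=> dia x y z /clos_rt_rt1n_iff xy /clos_rt_rt1n_iff xz.
suff [w yw zw] : exists2 w, clos_refl_trans_1n T step y w & clos_refl_trans_1n T step z w.
  by exists w; split; apply/clos_rt_rt1n_iff.
elim: xy z xz => {x y} [x | x u y xu uy IHy] z xz; first by exists z; [|constructor].
case: (diamond_strip dia xu xz) => v uv zv; case: (IHy v uv) => w yw vw.
exists w => //; case: zv => [-> // | zv].
exact: Relation_Operators.rt1n_trans vw.
Qed.

Lemma transfer_step_diamond (N : nat) : diamond (@transfer_step N).
Proof.
move=> c d e [i [def_ic ->]] [j [def_jc ->]].
have [eq_ij | ne_ij] := eqVneq i j.
  by left; apply/val_inj; rewrite /= eq_ij.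
have def_jd := transfer_defined_transfer def_ic ne_ij def_jc.
have def_ie : transfer_defined i (transfer def_jc).
  by apply: transfer_defined_transfer; rewrite // eq_sym.
right; exists (transfer def_jd); split; first by exists j, def_jd.
by exists i, def_ie; apply/val_inj; rewrite /= transfer_vecC.
Qed.

(** * Irreducible codes *)

Lemma irreducibleP (N : nat) (c : code N) :
  irreducible c <->
  (forall i : 'I_N.-1, 0 < c 0 (nxt i) ->
     c 0 (cur i) = cap (cur i) - 1 \/ c 0 (cur i) = cap (cur i)).
Proof.
split=> [/forallP irr_c i c_gt0 | irr_c].
  have := irr_c i; have := code_bound c (cur i).
  by rewrite /transfer_defined c_gt0 /=; lia.
apply/forallP => i; apply/negP => /andP[c_gt0 c_le].
by case: (irr_c i c_gt0); lia.
Qed.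

Lemma staircase0 (N : nat) : staircase (0 : 'rV[int]_N).
Proof. by apply/forallP => i; rewrite mxE /cap; have := ltn_ord i; lia. Qed.

(** The zero code. *)
Definition code0 (N : nat) : code N := Code 0 (staircase0 N).

Lemma irreducible_code0 (N : nat) : irreducible (code0 N).
Proof. by apply/forallP => i; rewrite /transfer_defined mxE ltxx. Qed.

(** A zero coordinate in an irreducible code propagates to the right: a positive
    coordinate after it would force it to be at least [C_i - 1 = C_(i+1) > 0]. *)
Lemma irreducible_head0 (N : nat) (c : code N.+1) :
  irreducible c -> c 0 ord0 = 0 -> c = code0 N.+1.
Proof.
move=> /irreducibleP irr_c c0; apply/val_inj/rowP => -[k lt_kN]; rewrite mxE.
elim: k lt_kN => [|k IHk] lt_kN; first by rewrite -[RHS]c0; congr (c 0 _); apply/val_inj.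
have ck := IHk (ltnW lt_kN).
pose i : 'I_N.+1.-1 := Ordinal (lt_kN : (k < N.+1.-1)%N).
have def_cur : cur i = Ordinal (ltnW lt_kN) by apply/val_inj.
have def_nxt : nxt i = Ordinal lt_kN by apply/val_inj.
have := irr_c i; have := code_bound c (nxt i).
rewrite def_cur def_nxt /= /cap /= ck; lia.
Qed.

(** * Counting irreducible codes *)

(** The code of length [N + 1] with first coordinate [a <= N] and tail [c];
    the caps of the tail are those of a code of length [N]. *)
Definition cons_row (N : nat) (a : 'I_N.+1) (c : code N) : 'rV[int]_N.+1 :=
  \row_i if unlift ord0 i is Some j then c 0 j else a%:Z.

Lemma cons_row_staircase (N : nat) (a : 'I_N.+1) (c : code N) :
  staircase (cons_row a c).
Proof.
apply/forallP => i; rewrite mxE; case: unliftP => [j ->|->].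
  by have := code_bound c j; rewrite /cap lift0; lia.
by rewrite /cap /=; have := ltn_ord a; lia.
Qed.

Definition cons_code (N : nat) (a : 'I_N.+1) (c : code N) : code N.+1 :=
  Code (cons_row a c) (cons_row_staircase a c).

Lemma cons_code0 (N : nat) (a : 'I_N.+1) (c : code N) : cons_code a c 0 ord0 = a%:Z.
Proof. by rewrite mxE unlift_none. Qed.

Lemma cons_codeS (N : nat) (a : 'I_N.+1) (c : code N) (j : 'I_N) :
  cons_code a c 0 (lift ord0 j) = c 0 j.
Proof. by rewrite mxE liftK. Qed.

Lemma tail_row_staircase (N : nat) (c : code N.+1) :
  staircase (\row_(j < N) c 0 (lift ord0 j)).
Proof.
apply/forallP => j; rewrite mxE.
by have := code_bound c (lift ord0 j); rewrite /cap lift0; lia.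
Qed.

(** The code with its first coordinate removed. *)
Definition tail_code (N : nat) (c : code N.+1) : code N :=
  Code _ (tail_row_staircase c).

Lemma cons_tail_code (N : nat) (c : code N.+1) :
  cons_code (inord `|c 0%R ord0|%N) (tail_code c) = c.
Proof.
apply/val_inj/rowP => i; rewrite /= mxE; case: unliftP => [j ->|->]; first by rewrite mxE.
by rewrite inordK ?code_lt //; have := code_bound c ord0; lia.
Qed.

Lemma cons_code_inj (N : nat) :
  injective (fun p : 'I_N.+1 * code N => cons_code p.1 p.2).
Proof.
move=> [a c] [b d] /= eq_cons; congr (_, _).
  by apply/val_inj; have := cons_code0 a c; rewrite eq_cons cons_code0 => -[].
by apply/val_inj/rowP => j; rewrite -(cons_codeS a) eq_cons cons_codeS.
Qed.

Lemma irreducible_cons (N : nat) (a : 'I_N.+1) (c : code N) :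
  irreducible (cons_code a c) = irreducible c && ((c == code0 N) || (N <= a.+1)%N).
Proof.
case: N a c => [|N] a c.
  have -> : c = code0 0 by apply/val_inj/rowP => -[].
  by rewrite eqxx irreducible_code0 /=; apply/forallP => -[].
have nxt0 : nxt (ord0 : 'I_N.+2.-1) = lift ord0 ord0 by apply/val_inj.
have cur0 : cur (ord0 : 'I_N.+2.-1) = ord0 by apply/val_inj.
have nxtS (j : 'I_N.+1.-1) :
    nxt (lift ord0 j : 'I_N.+2.-1) = lift ord0 (nxt j) by apply/val_inj.
have curS (j : 'I_N.+1.-1) :
    cur (lift ord0 j : 'I_N.+2.-1) = lift ord0 (cur j) by apply/val_inj.
have defS j : transfer_defined (lift ord0 j : 'I_N.+2.-1) (cons_code a c)
            = transfer_defined j c.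
  by rewrite /transfer_defined nxtS curS !cons_codeS /cap lift0; congr (_ && _); lia.
have def0 : transfer_defined (ord0 : 'I_N.+2.-1) (cons_code a c)
            = (0 < c 0 ord0) && (a < N)%N.
  rewrite /transfer_defined nxt0 cur0 cons_codeS cons_code0 /cap /=.
  by congr (_ && _); lia.
apply/idP/idP => [/forallP irr_ac | /andP[irr_c c0_or]].
  have irr_c : irreducible c by apply/forallP => j; rewrite -defS.
  rewrite irr_c /=; have := irr_ac ord0; rewrite def0 negb_and -leqNgt.
  case/orP=> [c_le0 | le_Na]; last by rewrite ltnS le_Na orbT.
  rewrite (irreducible_head0 irr_c) ?eqxx //.
  by have := code_bound c ord0; lia.
apply/forallP => i; case: (unliftP ord0 i) => [j ->|->].
  by rewrite defS; move/forallP: irr_c.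
rewrite def0; case/orP: c0_or => [/eqP-> | le_Na]; first by rewrite mxE ltxx.
by rewrite negb_and -leqNgt -ltnS le_Na orbT.
Qed.

Lemma card_top2 (N : nat) : #|[set a : 'I_N.+2 | (N.+1 <= a.+1)%N]| = 2.
Proof.
have -> : [set a : 'I_N.+2 | (N.+1 <= a.+1)%N] = [set ord_max; inord N].
  apply/setP => a; rewrite !inE -!val_eqE /= inordK //.
  by have := ltn_ord a; lia.
by rewrite cards2 -val_eqE /= inordK // eqn_leq ltnn.
Qed.

Lemma card_code_length0 : #|[set c : code 0 | irreducible c]| = 1%N.
Proof.
apply/eqP/cards1P; exists (code0 0); apply/setP => c; rewrite !inE.
have -> : c = code0 0 by apply/val_inj/rowP => -[].
by rewrite eqxx irreducible_code0.
Qed.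

Lemma card_irreducibleS (N : nat) :
  #|[set c : code N.+1 | irreducible c]|
  = (N.+1 + 2 * (#|[set c : code N | irreducible c]|).-1)%N.
Proof.
set I := [set c : code N | irreducible c].
set top := [set a : 'I_N.+1 | (N <= a.+1)%N].
have -> : [set c : code N.+1 | irreducible c]
  = (fun p : 'I_N.+1 * code N => cons_code p.1 p.2) @:
      (setX setT [set code0 N] :|: setX top (I :\ code0 N)).
  apply/setP => c; rewrite -[c]cons_tail_code.
  rewrite (mem_imset _ (inord `|c 0%R ord0|%N, tail_code c) (@cons_code_inj N)) !inE.
  rewrite irreducible_cons /=; case: eqP => [->|_].
    by rewrite irreducible_code0.
  by rewrite /= andbC.
rewrite (card_imset _ (@cons_code_inj N)) cardsU.
have -> : setX setT [set code0 N] :&: setX top (I :\ code0 N) = set0.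
  by apply/setP => -[a c]; rewrite !inE /=; case: eqP; rewrite ?andbF.
rewrite cards0 subn0 !cardsX cardsT card_ord cards1 muln1.
have card_I : #|I :\ code0 N| = #|I|.-1.
  by rewrite [#|I|](cardsD1 (code0 N)) inE irreducible_code0.
rewrite card_I; congr addn.
(* For [N = 0] only one first coordinate exists, but then no nonzero tail does. *)
rewrite /I /top; clear; case: N => [|N]; first by rewrite card_code_length0 !muln0.
by rewrite card_top2.
Qed.

Lemma card_irreducible (N : nat) :
  #|[set c : code N | irreducible c]| = (2 ^ N - N)%N.
Proof.
elim: N => [|N IHN]; first by rewrite card_code_length0.
rewrite card_irreducibleS IHN expnS.
have := ltn_expl N (ltnSn 1); lia.
Qed.

Theorem proposition14p4 (N : nat) :
  terminating (@transfer_step N) /\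
  confluent (@transfer_step N) /\
  (forall c : code N,
     irreducible c <->
     (forall i : 'I_N.-1,
        0 < c 0 (nxt i) ->
        c 0 (cur i) = cap (cur i) - 1 \/ c 0 (cur i) = cap (cur i))) /\
  #|[set c : code N | irreducible c]| = (2 ^ N - N)%N.
Proof.
split; first exact: terminating_transfer.
split; first exact/diamond_confluent/transfer_step_diamond.
by split; [exact: irreducibleP | exact: card_irreducible].
Qed.
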